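(* Let $\mathbb{I}=\{\mathbb{I}_1,\dots,\mathbb{I}_N\}$ be a random iterated function system on a compact metric space $(K,d)$ (see context), and write $h=\inf_{u\in\Omega}\dim_{\mathrm H}F_u$. Assume that $\mathbb{I}$ satisfies the $\mathcal{H}^h$-measure separated condition and that there exists $v=(v_1,v_2,\dots)\in\Omega$ such that $\lim_{l\to\infty}\sum_{j_1\in\mathcal{I}_{v_1},\dots,j_l\in\mathcal{I}_{v_l}}\mathrm{Lip}^-(S_{v_1,j_1}\circ\cdots\circ S_{v_l,j_l})^h=\infty.$ Then: (1) if $\inf_{u\in\Omega}\mathcal{H}^h(F_u)=0$, then for a typical $\omega\in\Omega$, $\mathcal{H}^h(F_\omega)=0$; (2) if $\inf_{u\in\Omega}\mathcal{H}^h(F_u)>0$, then for a typical $\omega\in\Omega$, $\mathcal{H}^h(F_\omega)=\infty$.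
   Context: A random iterated function system on a compact metric space $(K,d)$ is a finite set $\mathbb{I}=\{\mathbb{I}_1,\dots,\mathbb{I}_N\}$ with $\mathbb{I}_i=\{S_{i,j}\}_{j\in\mathcal{I}_i}$, $\mathcal{I}_i$ finite nonempty, each $S_{i,j}:K\to K$ a bi-Lipschitz contraction: $0<\mathrm{Lip}^-(S_{i,j})\le\mathrm{Lip}^+(S_{i,j})<1$ where $\mathrm{Lip}^-(\phi)=\inf_{x\ne y}d(\phi x,\phi y)/d(x,y)$, $\mathrm{Lip}^+(\phi)=\sup_{x\ne y}d(\phi x,\phi y)/d(x,y)$. $\Omega=\{1,\dots,N\}^{\mathbb{N}}$ and for $\omega\in\Omega$, $F_\omega=\bigcap_k\bigcup_{i_1\in\mathcal{I}_{\omega_1},\dots,i_k\in\mathcal{I}_{\omega_k}}S_{\omega_1,i_1}\circ\cdots\circ S_{\omega_k,i_k}(K)$. $\Omega$ has the metric $d_\Omega(u,v)=2^{-\min\{n:u_n\ne v_n\}}$; ''typical $\omega$'' means the set of such $\omega$ is residual (complement is a countable union of nowhere dense sets) in $(\Omega,d_\Omega)$. $\mathcal{H}^s$ denotes $s$-dimensional Hausdorff measure and $\dim_{\mathrm H}$ Hausdorff dimension. For a Borel measure $\mu$ on $K$, $\mathbb{I}$ satisfies the $\mu$-measure separated condition if for all $\omega\in\Omega$, $l\in\{1,\dots,N\}$ and $i\ne j$ in $\mathcal{I}_l$, $\mu(S_{l,i}(F_\omega)\cap S_{l,j}(F_\omega))=0$. *)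

(* Defs.v *)
From HB Require Import structures.
From mathcomp Require Import all_boot all_order all_algebra.
From mathcomp Require Import all_classical all_reals all_analysis.
Set Implicit Arguments. Unset Strict Implicit. Unset Printing Implicit Defensive.
Import Order.TTheory GRing.Theory Num.Theory.
Import numFieldNormedType.Exports.
Local Open Scope classical_set_scope.
Local Open Scope ring_scope.

Section Hausdorff.
Context {R : realType} {K : metricType R}.

(* diameter of a set (extended real; -oo for the empty set) *)
Definition diam (U : set K) : \bar R :=
  ereal_sup [set (mdist x y)%:E | x in U & y in U].

Definition cover_term (s : R) (U : set K) : \bar R :=
  if pselect (U = set0) then 0%E else
  match diam U with
  | r%:E => (r `^ s)%:E
  | +oo%E => +oo%E
  | -oo%E => 0%E
  end.

Definition Hdelta (s delta : R) (A : set K) : \bar R :=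
  ereal_inf [set (\sum_(0 <= i <oo) cover_term s (U i))%E
            | U in [set U : nat -> set K |
                     A `<=` \bigcup_i U i /\ forall i, (diam (U i) <= delta%:E)%E]].

Definition hausdorff (s : R) (A : set K) : \bar R :=
  ereal_sup [set Hdelta s delta A | delta in [set delta : R | 0 < delta]].

Definition dimH (A : set K) : \bar R :=
  ereal_inf [set s%:E | s in [set s : R | 0 <= s /\ hausdorff s A = 0%E]].

Definition Lipm (f : K -> K) : \bar R :=
  ereal_inf [set r | exists x y, x <> y /\ r = (mdist (f x) (f y) / mdist x y)%:E].
Definition Lipp (f : K -> K) : \bar R :=
  ereal_sup [set r | exists x y, x <> y /\ r = (mdist (f x) (f y) / mdist x y)%:E].

End Hausdorff.

(* The symbol space Omega = {1..N}^N (here indices 'I_N, positions from 0),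
   with the metric d(u,v) = 2^-(first position of disagreement, counted from 1). *)
Section SymbolSpace.
Context {R : realType} (N : nat).

Definition Omega := nat -> 'I_N.

Definition dOmega (u v : Omega) : R :=
  sup [set (2%:R ^- n.+1 : R) | n in [set n | u n != v n]].

Definition ballO (u : Omega) (r : R) : set Omega := [set v | dOmega u v < r].
Definition closureO (A : set Omega) : set Omega :=
  [set u | forall r : R, 0 < r -> exists v, A v /\ ballO u r v].
Definition interiorO (A : set Omega) : set Omega :=
  [set u | exists r : R, 0 < r /\ ballO u r `<=` A].
Definition nowhere_denseO (A : set Omega) := interiorO (closureO A) = set0.
Definition residualO (P : set Omega) :=
  exists E : nat -> set Omega, (forall n, nowhere_denseO (E n)) /\
    ~` P `<=` \bigcup_n E n.
End SymbolSpace.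

(* Random iterated function systems: I l (a finite nonempty set of indices,
   encoded inside 'I_B) indexes the maps S l j, j \in I l, of the system I_l. *)
Section RIFS.
Context {R : realType} {K : metricType R} {N B : nat}
  (I : 'I_N -> {set 'I_B}) (S : 'I_N -> 'I_B -> K -> K).

Fixpoint compw (v : Omega N) (n : nat) (s : seq 'I_B) : K -> K :=
  match s with
  | [::] => id
  | j :: s' => S (v n) j \o compw v n.+1 s'
  end.

Definition validw (v : Omega N) (k : nat) (t : k.-tuple 'I_B) : bool :=
  [forall m : 'I_k, tnth t m \in I (v m)].

Definition attractor (v : Omega N) : set K :=
  \bigcap_(k in [set: nat])
    \bigcup_(t in [set t : k.-tuple 'I_B | validw v t]) (compw v 0 t) @` [set: K].

(* h = inf_u dim_H F_u  (finite for such systems) *)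
Definition hdim : R := fine (ereal_inf [set dimH (attractor u) | u in [set: Omega N]]).

Definition measure_separated (mu : set K -> \bar R) :=
  forall (w : Omega N) (l : 'I_N) (i j : 'I_B), i \in I l -> j \in I l -> i != j ->
    mu ((S l i) @` attractor w `&` (S l j) @` attractor w) = 0%E.

Definition lip_sum (v : Omega N) (s : R) (l : nat) : R :=
  \sum_(t : l.-tuple 'I_B | validw v t) (fine (Lipm (compw v 0 t))) `^ s.

End RIFS.

(* Main.v *)
(* Under a fixed prefix of length [k], the attractor of [w] is a finite union of
   bi-Lipschitz copies of the attractor of the shifted sequence.

   If [H^h] has infimum 0 over all attractors, every cylinder therefore contains
   some [w] whose attractor has small [H^h]; covering that compact attractor by
   open sets shows that [H^h_delta] stays small on a whole cylinder around [w].

   If [H^h] is at least [c > 0] on all attractors, the separation condition makes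
   [H^h] additive over the level-[l] pieces, so every attractor whose sequence
   starts with [v_1 ... v_l] has [H^h] at least [c] times the [l]-th Lipschitz sum
   of [v]. Hence [H^h] is arbitrarily large on a subcylinder of every cylinder. *)
Require Import Defs.
From HB Require Import structures.
From mathcomp Require Import all_boot all_order all_algebra.
From mathcomp Require Import all_classical all_reals all_analysis.
From mathcomp Require Import lra.
Set Implicit Arguments. Unset Strict Implicit. Unset Printing Implicit Defensive.
Import Order.TTheory GRing.Theory Num.Theory.
Import numFieldNormedType.Exports.
Local Open Scope classical_set_scope.
Local Open Scope ring_scope.

(** * Hausdorff measure *)

Section HausdorffMeasure.
Context {R : realType} {K : metricType R}.
Implicit Types (s r c delta : R) (U V A B : set K).

Lemma diam_leP U r :
  (diam U <= r%:E)%E <-> forall x y, U x -> U y -> mdist x y <= r.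
Proof.
split=> [/ereal_supP H x y Ux Uy|H].
  by rewrite -lee_fin; apply: H; exists x => //; exists y.
by apply/ereal_supP => _ [x Ux [y Uy <-]]; rewrite lee_fin; exact: H.
Qed.

Lemma mdist_le_diam U x y : U x -> U y -> ((mdist x y)%:E <= diam U)%E.
Proof. by move=> Ux Uy; apply: ereal_sup_ubound; exists x => //; exists y. Qed.

Lemma diam_ge0 U x : U x -> (0 <= diam U)%E.
Proof. by move=> Ux; have := mdist_le_diam Ux Ux; rewrite mdistxx. Qed.

Lemma cover_term0 s : cover_term s (set0 : set K) = 0%E.
Proof. by rewrite /cover_term; case: pselect => /=. Qed.

Lemma cover_term_ge0 s U : (0 <= cover_term s U)%E.
Proof.
rewrite /cover_term; case: pselect => //= _.
by case: (diam U) => [r||]//; rewrite lee_fin powR_ge0.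
Qed.

Lemma cover_termE s U r : U !=set0 -> diam U = r%:E ->
  cover_term s U = (r `^ s)%:E.
Proof.
move=> /set0P/eqP U0 dU; rewrite /cover_term; case: pselect => //= _.
by rewrite dU.
Qed.

Lemma cover_term_le_powR s U r : 0 <= s -> 0 <= r -> (diam U <= r%:E)%E ->
  (cover_term s U <= (r `^ s)%:E)%E.
Proof.
move=> s0 r0; rewrite /cover_term; case: pselect => /= [_ _|U0].
  by rewrite lee_fin powR_ge0.
have [x Ux] : U !=set0 by apply/set0P/eqP.
have := diam_ge0 Ux; case: (diam U) => [d||]//.
by rewrite !lee_fin => d0 dr; apply: ge0_ler_powR => //; rewrite nnegrE.
Qed.

Lemma cover_term_scale s L U V : 0 <= s -> 0 < L ->
  (U !=set0 -> V !=set0) -> (diam U <= L%:E * diam V)%E ->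
  (cover_term s U <= (L `^ s)%:E * cover_term s V)%E.
Proof.
move=> s0 L0 UV dUV; have Ls0 : 0 < L `^ s by rewrite powR_gt0.
have [->|/set0P U0] := eqVneq U set0.
  by rewrite cover_term0 mule_ge0 ?cover_term_ge0 ?lee_fin ?ltW.
have [x Vx] := UV U0; have := diam_ge0 Vx.
case dV : (diam V) dUV => [d||]// dUV d0.
  rewrite (cover_termE _ (UV U0) dV) -EFinM -powRM ?(ltW L0)//.
  by apply: cover_term_le_powR => //; rewrite mulr_ge0// ltW.
rewrite {2}/cover_term; case: pselect => /= [V0|_]; first by rewrite V0 in Vx.
by rewrite dV gt0_muley ?leey// lte_fin.
Qed.

Lemma cover_term_mono s U V : 0 <= s -> U `<=` V ->
  (cover_term s U <= cover_term s V)%E.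
Proof.
move=> s0 UV; rewrite -[leRHS]mul1e (_ : 1%E = (1 `^ s)%:E); last by rewrite powR1.
apply: cover_term_scale => //; first by move=> [x /UV Vx]; exists x.
rewrite mul1e; apply: ereal_sup_le => _ [x Ux [y Uy <-]].
by exists x; [exact: UV|exists y => //; exact: UV].
Qed.

Lemma nneseries_le_partial (u : nat -> \bar R) (c : \bar R) :
  (forall i, 0 <= u i)%E -> (forall n, \sum_(0 <= i < n) u i <= c)%E ->
  (\sum_(0 <= i <oo) u i <= c)%E.
Proof.
move=> u0 uc; apply: lime_le; first by apply: is_cvg_nneseries => n _ _; exact: u0.
by apply: nearW => n; exact: uc.
Qed.

Lemma Hdelta_le_cover s delta A (U : nat -> set K) :
  A `<=` \bigcup_i U i -> (forall i, diam (U i) <= delta%:E)%E ->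
  (Hdelta s delta A <= \sum_(0 <= i <oo) cover_term s (U i))%E.
Proof. by move=> AU dU; apply: ereal_inf_lbound; exists U. Qed.

Lemma Hdelta_lt_cover s delta A (c : \bar R) : (Hdelta s delta A < c)%E ->
  exists U : nat -> set K, [/\ A `<=` \bigcup_i U i,
    forall i, (diam (U i) <= delta%:E)%E &
    (\sum_(0 <= i <oo) cover_term s (U i) < c)%E].
Proof. by move=> /ereal_inf_lt[_ [U [AU dU] <-] Uc]; exists U. Qed.

Lemma Hdelta_ge0 s delta A : (0 <= Hdelta s delta A)%E.
Proof.
apply/ereal_infP => _ [U _ <-]; apply: nneseries_ge0 => i _ _.
exact: cover_term_ge0.
Qed.

Lemma HdeltaS s delta A B : A `<=` B -> (Hdelta s delta A <= Hdelta s delta B)%E.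
Proof.
move=> AB; apply: ereal_inf_le_tmp => _ [U [BU dU] <-]; exists U => //.
by split=> //; exact: subset_trans BU.
Qed.

Lemma Hdelta_antimono s delta delta' A : delta <= delta' ->
  (Hdelta s delta' A <= Hdelta s delta A)%E.
Proof.
move=> dd; apply: ereal_inf_le_tmp => _ [U [AU dU] <-]; exists U => //.
by split=> // i; apply: le_trans (dU i) _; rewrite lee_fin.
Qed.

Lemma HdeltaU s delta A B :
  (Hdelta s delta (A `|` B) <= Hdelta s delta A + Hdelta s delta B)%E.
Proof.
have [A0 B0] := (Hdelta_ge0 s delta A, Hdelta_ge0 s delta B).
case HA : (Hdelta s delta A) A0 => [a||]// _; last first.
  by rewrite addye ?leey// gt_eqF// (lt_le_trans _ B0)// ltNy0.
case HB : (Hdelta s delta B) B0 => [b||]// _; last by rewrite addey ?leey.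
apply/lee_addgt0Pr => e e0; have e2 : 0 < e / 2 by rewrite divr_gt0.
have [|U [AU dU sU]] := @Hdelta_lt_cover s delta A (a + e / 2)%:E.
  by rewrite HA lte_fin ltrDl.
have [|V [BV dV sV]] := @Hdelta_lt_cover s delta B (b + e / 2)%:E.
  by rewrite HB lte_fin ltrDl.
(* The two covers are interleaved into one: even indices list [U], odd indices list [V], so the
   first [2n] weights split as in [W2]. *)
pose W n := if odd n then V n./2 else U n./2.
have W2 n : (\sum_(0 <= i < n.*2) cover_term s (W i) =
    \sum_(0 <= i < n) cover_term s (U i) + \sum_(0 <= i < n) cover_term s (V i))%E.
  elim: n => [|n IH]; first by rewrite double0 !big_geq ?adde0.
  rewrite doubleS !big_nat_recr//= IH /W /= odd_double /= uphalf_double doubleK.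
  by rewrite -[LHS]addeA addeACA.
have ct0 (X : nat -> set K) i : (0 <= cover_term s (X i))%E by exact: cover_term_ge0.
have AW : A `|` B `<=` \bigcup_i W i.
  move=> x [/AU[i _ Ui]|/BV[i _ Vi]]; [exists i.*2 | exists i.*2.+1] => //.
    by rewrite /W odd_double doubleK.
  by rewrite /W /= odd_double /= uphalf_double.
apply: le_trans (@Hdelta_le_cover s delta _ W AW _) _.
  by move=> i; rewrite /W; case: ifP.
apply: (@le_trans _ _ (\sum_(0 <= i <oo) cover_term s (U i) +
    \sum_(0 <= i <oo) cover_term s (V i))%E).
  apply: nneseries_le_partial => // n.
  apply: (@le_trans _ _ (\sum_(0 <= i < n.*2) cover_term s (W i))%E).
    by apply: lee_sum_nneg_natr => //; rewrite -addnn leq_addr.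
  by rewrite W2; apply: leeD; apply: nneseries_lim_ge.
rewrite (le_trans (leeD (ltW sU) (ltW sV)))// -!EFinD lee_fin; lra.
Qed.

Lemma Hdelta_le_hausdorff s delta A : 0 < delta ->
  (Hdelta s delta A <= hausdorff s A)%E.
Proof. by move=> d0; apply: ereal_sup_ubound; exists delta. Qed.

Lemma hausdorff_leP s A (c : \bar R) :
  (hausdorff s A <= c)%E <-> forall delta, 0 < delta -> (Hdelta s delta A <= c)%E.
Proof.
split=> [Ac d d0|H]; first exact: le_trans (Hdelta_le_hausdorff _ _ d0) Ac.
by apply/ereal_supP => _ [d d0 <-]; exact: H.
Qed.

Lemma hausdorff_ge0 s A : (0 <= hausdorff s A)%E.
Proof.
by apply: le_trans (Hdelta_ge0 s 1 A) _; apply: Hdelta_le_hausdorff.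
Qed.

Lemma hausdorffS s A B : A `<=` B -> (hausdorff s A <= hausdorff s B)%E.
Proof.
move=> AB; apply/hausdorff_leP => d d0.
exact: le_trans (HdeltaS _ _ AB) (Hdelta_le_hausdorff _ _ d0).
Qed.

Lemma hausdorff_null_sub s A B : A `<=` B -> hausdorff s B = 0%E ->
  hausdorff s A = 0%E.
Proof.
by move=> AB B0; apply/eqP; rewrite eq_le hausdorff_ge0 andbT -B0 hausdorffS.
Qed.

Lemma hausdorffU s A B :
  (hausdorff s (A `|` B) <= hausdorff s A + hausdorff s B)%E.
Proof.
apply/hausdorff_leP => d d0; apply: le_trans (HdeltaU _ _ _ _) _.
by apply: leeD; exact: Hdelta_le_hausdorff.
Qed.

Lemma hausdorff0 s : hausdorff s (set0 : set K) = 0%E.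
Proof.
apply/eqP; rewrite eq_le hausdorff_ge0 andbT; apply/hausdorff_leP => d d0.
apply: le_trans (@Hdelta_le_cover s d _ (fun=> set0) _ _) _ => //.
  by move=> i; apply/diam_leP.
by rewrite eseries0 // => i _ _; rewrite cover_term0.
Qed.

Lemma hausdorff_bigsetU (T : Type) (r : seq T) (P : pred T) (F : T -> set K) s :
  (hausdorff s (\big[setU/set0]_(i <- r | P i) F i)
    <= \sum_(i <- r | P i) hausdorff s (F i))%E.
Proof.
elim: r => [|a r IH]; first by rewrite !big_nil hausdorff0.
rewrite !big_cons; case: ifP => // _.
by apply: le_trans (hausdorffU _ _ _) _; exact: leeD.
Qed.

(* Taking [g := id] bounds the image under a Lipschitz map from above; taking
   [f := id] bounds the image under an expanding map from below. *)
Lemma hausdorff_image_le (T : Type) (f g : T -> K) (X : set T) s L :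
  0 <= s -> 0 < L -> (forall x y, mdist (f x) (f y) <= L * mdist (g x) (g y)) ->
  (hausdorff s (f @` X) <= (L `^ s)%:E * hausdorff s (g @` X))%E.
Proof.
move=> s0 L0 fg; have Ls0 : 0 < L `^ s by rewrite powR_gt0.
apply/hausdorff_leP => d d0; have dL0 : 0 < d / L by rewrite divr_gt0.
apply: le_trans (_ : _ <= (L `^ s)%:E * Hdelta s (d / L) (g @` X))%E _; last first.
  by rewrite lee_pmul2l ?lte_fin// Hdelta_le_hausdorff.
rewrite -lee_pdivrMl//; apply/ereal_infP => _ [U [XU dU] <-]; rewrite lee_pdivrMl//.
pose V i := f @` (g @^-1` U i).
have diamV i : (diam (V i) <= L%:E * diam (U i))%E.
  apply/ereal_supP => _ [_ [x Ux <-] [_ [y Uy <-] <-]].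
  apply: le_trans (_ : _ <= L%:E * (mdist (g x) (g y))%:E)%E _.
    by rewrite -EFinM lee_fin.
  by rewrite lee_pmul2l ?lte_fin//; exact: mdist_le_diam.
apply: le_trans (@Hdelta_le_cover s d _ V _ _) _.
- move=> _ [x Xx <-]; have [|i _ Ui] := XU (g x); first by exists x.
  by exists i => //; exists x.
- move=> i; apply: le_trans (diamV i) _.
  apply: le_trans (_ : _ <= L%:E * (d / L)%:E)%E _.
    by rewrite lee_pmul2l ?lte_fin.
  by rewrite -EFinM mulrC divfK ?gt_eqF.
rewrite -nneseriesZl; last by move=> i _; exact: cover_term_ge0.
apply: lee_nneseries => [i _ _|i _]; first exact: cover_term_ge0.
by apply: cover_term_scale => // -[_ [x Ux _]]; exists (g x).
Qed.

End HausdorffMeasure.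

(** * Open covers, and additivity of Hausdorff measure over compact pieces *)

Section CompactPieces.
Context {R : realType} {K : metricType R}.
Implicit Types (s r c delta : R) (U V A B : set K).

(** Small balls of radius [eta] around the points of [V] raise the diameter by at most [2 * eta],
    and continuity of the power keeps the weight under control. *)
Lemma open_enlargement s delta e V : 0 <= s -> 0 < delta -> 0 < e ->
  (diam V <= delta%:E)%E -> exists W, [/\ open W, V `<=` W,
    (diam W <= (2 * delta)%:E)%E & (cover_term s W <= cover_term s V + e%:E)%E].
Proof.
move=> s0 d0 e0 dV; have [->|/set0P V0] := eqVneq V set0.
  exists set0; split=> //; first exact: open0.
    by apply/diam_leP.
  by rewrite cover_term0 add0e lee_fin ltW.
have [x0 Vx0] := V0; have := diam_ge0 Vx0.
case rV : (diam V) dV => [r||]//; rewrite !lee_fin => rd r0.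
(* The increment [t] solves [(r + t)^s = r^s + e]. For [s = 0] there is no such root, but both
   powers are 1 and any [t] serves. *)
have [t t0 ts] : exists2 t, 0 < t & (r + t) `^ s <= r `^ s + e.
  have [->|sn0] := eqVneq s 0; first by exists 1; rewrite // !powRr0 lerDl ltW.
  have sp : 0 < s by rewrite lt_neqAle eq_sym sn0.
  have u0 : 0 <= r `^ s + e by rewrite addr_ge0 ?powR_ge0// ltW.
  exists ((r `^ s + e) `^ s^-1 - r); last first.
    by rewrite addrCA subrr addr0 -powRrM mulVf// powRr1.
  rewrite subr_gt0 -[ltLHS]powRr1// -[X in r `^ X](divff sn0) powRrM.
  by apply: gt0_ltr_powR; rewrite ?invr_gt0 ?nnegrE ?powR_ge0 ?ltrDl.
(* The bound [t / 2] controls the weight and [delta / 2] the diameter: [r + 2 * eta] is at most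
   [r + t] and at most [2 * delta]. *)
pose eta := Num.min (t / 2) (delta / 2).
have eta0 : 0 < eta by rewrite lt_min !divr_gt0.
pose W := \bigcup_(x in V) (ball x eta)^°.
have dW : (diam W <= (r + 2 * eta)%:E)%E.
  apply/diam_leP => x y [a Va /interior_subset ax] [b Vb /interior_subset yb].
  move: ax yb; rewrite !ballEmdist /= => ax yb.
  have ab : mdist a b <= r by rewrite -lee_fin -rV; exact: mdist_le_diam.
  have := metric_triangle x a y; have := metric_triangle a b y.
  rewrite (metric_sym x a); lra.
exists W; split.
- by apply: bigcup_open => x _; exact: open_interior.
- by move=> x Vx; exists x => //; exact: nbhsx_ballx.
- apply: le_trans dW _; rewrite lee_fin.
  have : eta <= delta / 2 by rewrite ge_min lexx orbT.
  lra.
- have etat : eta <= t / 2 by rewrite ge_min lexx.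
  rewrite (cover_termE _ V0 rV) -EFinD.
  apply: le_trans (_ : _ <= ((r + t) `^ s)%:E)%E _; last by rewrite lee_fin.
  apply: cover_term_le_powR => //; first by rewrite addr_ge0// ltW.
  by apply: le_trans dW _; rewrite lee_fin; lra.
Qed.

Lemma Hdelta_lt_open_cover s delta A c : 0 <= s -> 0 < delta ->
  (Hdelta s delta A < c%:E)%E -> exists U : nat -> set K,
  [/\ forall i, open (U i), A `<=` \bigcup_i U i,
      forall i, (diam (U i) <= (2 * delta)%:E)%E &
      (\sum_(0 <= i <oo) cover_term s (U i) < c%:E)%E].
Proof.
move=> s0 d0 /Hdelta_lt_cover[V [AV dV sV]].
have : (0 <= \sum_(0 <= i <oo) cover_term s (V i))%E.
  by apply: nneseries_ge0 => i _ _; exact: cover_term_ge0.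
case SV : (\sum_(0 <= i <oo) cover_term s (V i))%E sV => [a||]//.
(* Only half of the gap to [c] is spent, since the enlarged cover is bounded non-strictly by
   [a + e]; the [i]-th set receives [e / 2^(i+1)]. *)
rewrite lte_fin => ac _; pose e := (c - a) / 2.
have e0 : 0 < e by rewrite divr_gt0// subr_gt0.
have /choice[U HU] i := @open_enlargement s delta (e / (2 ^ i.+1)%:R) (V i) s0 d0
  ltac:(by rewrite divr_gt0// ltr0n expn_gt0) (dV i).
exists U; split.
- by move=> i; have [] := HU i.
- by move=> x /AV[i _ Vx]; exists i => //; have [_ + _ _] := HU i; apply.
- by move=> i; have [] := HU i.
- apply: le_lt_trans (_ : _ <= (a + e)%:E)%E _; last by rewrite lte_fin /e; lra.
  rewrite EFinD -SV; apply: le_trans _ (epsilon_trick _ _ _); last 2 first.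
  + by move=> n; exact: cover_term_ge0.
  + exact: ltW.
  apply: lee_nneseries => [i _ _|i _]; first exact: cover_term_ge0.
  by have [] := HU i.
Qed.

(** Around each point of [A] a ball misses [B]; on the ball of half the radius every bound below
    that half is valid, and compactness makes one bound valid on all of [A]. *)
Lemma compact_disjoint_separated A B : compact A -> closed B ->
  A `&` B = set0 -> exists2 eta : R, 0 < eta &
  forall a b, A a -> B b -> eta <= mdist a b.
Proof.
move=> /compact_near_coveringP cA cB AB0.
have [e /= e0 He] : \forall e \near 0^'+, A `<=` [set a | forall b, B b -> e <= mdist a b].
  apply: (cA R (0^'+ : set_system R) (fun e a => forall b, B b -> e <= mdist a b)).
  move=> a Aa; have : nbhs a (~` B).
    apply: open_nbhs_nbhs; split; first exact: closed_openC.
    by move=> Ba; have : (A `&` B) a by []; rewrite AB0.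
  move=> /nbhs_ballP[r /= r0 rB].
  exists (ball a (r / 2), [set e | e < r / 2]) => /=.
    split; first by apply: nbhsx_ballx; rewrite divr_gt0.
    by apply: nbhs_right_lt; rewrite divr_gt0.
  move=> [x e] /= []; rewrite ballEmdist /= => ax er b Bb.
  rewrite leNgt; apply/negP => xb; apply: (rB b) Bb.
  rewrite ballEmdist /=; have := metric_triangle a x b; lra.
(* [He] speaks of positive numbers strictly below [e], hence the half. *)
exists (e / 2); first by rewrite divr_gt0.
move=> a b Aa Bb; apply: (He (e / 2)) => //=; last by rewrite divr_gt0.
by rewrite sub0r normrN gtr0_norm ?divr_gt0//; lra.
Qed.

(** A covering set of diameter below [eta] meets at most one of the two sets, so each term of a fine
    cover is charged only once. *)
Lemma hausdorffU_separated s A B eta : 0 <= s -> 0 < eta ->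
  (forall a b, A a -> B b -> eta <= mdist a b) ->
  (hausdorff s A + hausdorff s B <= hausdorff s (A `|` B))%E.
Proof.
move=> s0 eta0 sep.
(* With independent scales the two suprema can be taken one after the other; finiteness of the terms
   allows moving them across the inequality. *)
suff H d1 d2 : 0 < d1 -> 0 < d2 ->
    (Hdelta s d1 A + Hdelta s d2 B <= hausdorff s (A `|` B))%E.
  have [A0 B0] := (hausdorff_ge0 s A, hausdorff_ge0 s B).
  case hAB : (hausdorff s (A `|` B)) H => [c||] H; [|exact: leey|]; last first.
    by have := hausdorff_ge0 s (A `|` B); rewrite hAB.
  have cA : (hausdorff s A <= c%:E)%E by rewrite -hAB; apply: hausdorffS => x; left.
  have cB : (hausdorff s B <= c%:E)%E by rewrite -hAB; apply: hausdorffS => x; right.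
  have fA : hausdorff s A \is a fin_num by rewrite ge0_fin_numE// (le_lt_trans cA) ?ltry.
  have fB : hausdorff s B \is a fin_num by rewrite ge0_fin_numE// (le_lt_trans cB) ?ltry.
  rewrite -leeBrDr//; apply/hausdorff_leP => d1 d10.
  have f1 : Hdelta s d1 A \is a fin_num.
    rewrite ge0_fin_numE ?Hdelta_ge0//; apply: le_lt_trans (ltry c).
    by apply: le_trans cA; exact: Hdelta_le_hausdorff.
  rewrite leeBrDr// addeC -leeBrDr//; apply/hausdorff_leP => d2 d20.
  by rewrite leeBrDr// addeC; exact: H.
move=> d10 d20; pose d := Num.min (Num.min d1 d2) (eta / 2).
have d0 : 0 < d by rewrite !lt_min d10 d20 divr_gt0.
have dd1 : d <= d1 by rewrite !ge_min lexx.
have dd2 : d <= d2 by rewrite !ge_min lexx orbT.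
have deta : d < eta.
  by apply: le_lt_trans (_ : _ <= eta / 2) _; [rewrite ge_min lexx orbT|lra].
apply: le_trans (Hdelta_le_hausdorff _ _ d0).
apply/ereal_infP => _ [U [ABU dU] <-].
apply: le_trans (_ : _ <= \sum_(0 <= i <oo) cover_term s (U i `&` A)
   + \sum_(0 <= i <oo) cover_term s (U i `&` B))%E _.
  apply: leeD; [apply: le_trans (Hdelta_antimono _ _ dd1) _|
                apply: le_trans (Hdelta_antimono _ _ dd2) _].
  - apply: Hdelta_le_cover => [x Ax|i].
      by have [|i _ Ux] := ABU x; [left|exists i].
    by apply/diam_leP => x y [Ux _] [Uy _]; move/diam_leP: (dU i); apply.
  - apply: Hdelta_le_cover => [x Ax|i].
      by have [|i _ Ux] := ABU x; [right|exists i].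
    by apply/diam_leP => x y [Ux _] [Uy _]; move/diam_leP: (dU i); apply.
rewrite -nneseriesD; [|by move=> *; exact: cover_term_ge0..].
apply: lee_nneseries => [i _ _|i _]; first by rewrite adde_ge0 ?cover_term_ge0.
have [->|/set0P[a [Ua Aa]]] := eqVneq (U i `&` A) set0.
  by rewrite cover_term0 add0e; apply: cover_term_mono => // x [].
have [->|/set0P[b [Ub Bb]]] := eqVneq (U i `&` B) set0.
  by rewrite cover_term0 adde0; apply: cover_term_mono => // x [].
have := sep _ _ Aa Bb; rewrite leNgt => /negP[]; apply: le_lt_trans deta.
by move/diam_leP: (dU i); apply.
Qed.

(* Cutting off from [A] an open neighbourhood of the null set [A `&` B] makes
   the two pieces positively separated and, the neighbourhood being a cover of
   small total weight, costs little at scale [delta]. *)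
Lemma hausdorffU_null s A B : 0 <= s -> compact A -> compact B ->
  hausdorff s (A `&` B) = 0%E ->
  (hausdorff s A + hausdorff s B <= hausdorff s (A `|` B))%E.
Proof.
move=> s0 cA cB AB0.
have clB : closed B by apply: compact_closed => //; exact: metric_hausdorff.
case hAB : (hausdorff s (A `|` B)) => [c||]; [|exact: leey|]; last first.
  by have := hausdorff_ge0 s (A `|` B); rewrite hAB.
have cB' : (hausdorff s B <= c%:E)%E by rewrite -hAB; apply: hausdorffS => x; right.
have fB : hausdorff s B \is a fin_num.
  by rewrite ge0_fin_numE ?hausdorff_ge0// (le_lt_trans cB') ?ltry.
rewrite -leeBrDr//; apply/hausdorff_leP => d d0; rewrite leeBrDr//.
apply/lee_addgt0Pr => e e0.
have d2 : 0 < d / 2 by rewrite divr_gt0.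
have [|U [oU ABU dU sU]] := @Hdelta_lt_open_cover s (d / 2) (A `&` B) e s0 d2.
  by apply: le_lt_trans (Hdelta_le_hausdorff _ _ d2) _; rewrite AB0 lte_fin.
pose G := \bigcup_i U i; have oG : open G by apply: bigcup_open => i _.
have [eta eta0 sep] : exists2 eta : R, 0 < eta &
    forall a b, (A `&` ~` G) a -> B b -> eta <= mdist a b.
  apply: compact_disjoint_separated => //.
    by apply: compact_closedI => //; exact: open_closedC.
  by rewrite -subset0 => x [[Ax nG] Bx]; apply: nG; exact: ABU.
have AG : (Hdelta s d A <= Hdelta s d (A `&` ~` G) + e%:E)%E.
  apply: le_trans (_ : _ <= Hdelta s d ((A `&` ~` G) `|` G))%E _.
    by apply: HdeltaS => x Ax; have [Gx|nGx] := pselect (G x); [right|left].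
  apply: le_trans (HdeltaU _ _ _ _) _; apply: leeD => //.
  apply: le_trans (ltW sU); apply: Hdelta_le_cover => // i.
  by apply: le_trans (dU i) _; rewrite lee_fin mulrC divfK.
apply: le_trans (leeD AG (lexx _)) _; rewrite addeAC; apply: leeD => //.
rewrite -hAB; apply: le_trans (_ : _ <= hausdorff s ((A `&` ~` G) `|` B))%E _.
  apply: le_trans (hausdorffU_separated s0 eta0 sep).
  by apply: leeD => //; exact: Hdelta_le_hausdorff.
by apply: hausdorffS => x [[Ax _]|Bx]; [left|right].
Qed.

(** Induction on the list: the head meets the union of the rest in a finite union of null sets,
    [uniq] making its index differ from all later ones. *)
Lemma hausdorff_bigsetU_null (T : eqType) (r : seq T) (P : pred T)
    (F : T -> set K) s : 0 <= s -> uniq r ->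
  (forall i, P i -> compact (F i)) ->
  (forall i j, P i -> P j -> i != j -> hausdorff s (F i `&` F j) = 0%E) ->
  (\sum_(i <- r | P i) hausdorff s (F i)
    <= hausdorff s (\big[setU/set0]_(i <- r | P i) F i))%E.
Proof.
move=> s0 + cF Fnull; elim: r => [|a r IH] /=; first by rewrite !big_nil hausdorff0.
move=> /andP[ar ur]; rewrite !big_cons; case: ifPn => [Pa|_]; last exact: IH.
apply: le_trans (leeD (lexx _) (IH ur)) _; apply: hausdorffU_null => //.
- exact: cF.
- exact: bigsetU_compact.
apply/eqP; rewrite eq_le hausdorff_ge0 andbT big_distrr /=.
apply: le_trans (hausdorff_bigsetU _ _ _ _) _.
rewrite big_seq_cond big1// => i /andP[ir Pi]; apply: Fnull => //.
by apply: contraNneq ar => ->.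
Qed.

End CompactPieces.

(** * Sequences and attractors *)

Section Symbolic.
Context {N : nat}.
Implicit Types (u v w : Omega N).

Definition shift w : Omega N := fun n => w n.+1.

Definition scons (a : 'I_N) w : Omega N := fun n => if n is m.+1 then w m else a.

Definition agree k u v := forall i, (i < k)%N -> u i = v i.

Lemma agree_shift k u v : agree k.+1 u v -> agree k (shift u) (shift v).
Proof. by move=> uv i ik; exact: uv. Qed.

Lemma agree_scons k u v : agree k u (shift v) -> agree k.+1 (scons (v 0%N) u) v.
Proof. by move=> uv [|i] ik //=; rewrite uv. Qed.

Lemma agree_sym k u v : agree k u v -> agree k v u.
Proof. by move=> uv i ik; rewrite uv. Qed.

Lemma dOmega_le (R : realType) k u v : agree k u v ->
  dOmega u v <= 2%:R ^- k.+1 :> R.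
Proof.
move=> uv; rewrite /dOmega; set X := [set _ | _ in _].
(* Equal sequences leave the set empty, and its [sup] is then 0 by convention. *)
have [->|/set0P X0] := eqVneq X set0; first by rewrite sup0 invr_ge0 exprn_ge0.
apply: ge_sup => // _ [n /= nuv <-].
rewrite lef_pV2 ?posrE ?exprn_gt0// ler_eXn2l ?ltr1n// ltnS leqNgt.
by apply/negP => nk; move: nuv; rewrite uv ?eqxx.
Qed.

(** Positions count from 0: a disagreement at [i < k] alone contributes [2^-(i+1)], which is at
    least [2^-k]. *)
Lemma dOmega_lt_agree (R : realType) k u v : dOmega u v < 2%:R ^- k :> R ->
  agree k u v.
Proof.
move=> duv i ik; apply/eqP/negPn/negP => uvi.
move: duv; rewrite ltNge => /negP; apply.
apply: (@le_trans _ _ (2%:R ^- i.+1)).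
  by rewrite lef_pV2 ?posrE ?exprn_gt0// ler_eXn2l ?ltr1n.
apply: ub_le_sup; last by exists i.
exists 1 => _ [n _ <-]; rewrite invf_le1 ?exprn_gt0//.
by rewrite exprn_ege1// ler1n.
Qed.

(** The exceptional sets are the complements of the [G n]. A ball inside the closure of such a
    complement would contain a cylinder, hence a point [w'] with a whole cylinder inside [G n],
    which the complement cannot approach. *)
Lemma residualO_cylinders (R : realType) (G : nat -> set (Omega N)) (P : set (Omega N)) :
  (forall n w k, exists w' l, agree k w' w /\ forall u, agree l u w' -> G n u) ->
  (forall w, (forall n, G n w) -> P w) -> residualO (R := R) P.
Proof.
move=> HG GP; exists (fun n => ~` G n); split; last first.
  move=> w /= nPw; apply: contrapT => nE; apply: nPw; apply: GP => n.
  by apply: contrapT => nG; apply: nE; exists n.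
move=> n; rewrite /nowhere_denseO -subset0 => u [r [r0 uE]].
have [k _ /(_ k (leqnn k)) /= kr] := near_infty_natSinv_expn_lt (PosNum r0).
have [w [l [wu HGw]]] := HG n u k.
have /uE /(_ (2%:R ^- l)) : ballO u r w.
  apply: le_lt_trans (dOmega_le R (agree_sym wu)) _; apply: le_lt_trans kr.
  by rewrite div1r lef_pV2 ?posrE ?exprn_gt0// ler_eXn2l ?ltr1n.
case; first by rewrite invr_gt0 exprn_gt0.
move=> v [nGv /dOmega_lt_agree wv]; apply: nGv; apply: HGw; exact: agree_sym.
Qed.

End Symbolic.

(** * Words, prefractals and attractors *)

Section Attractors.
Context {R : realType} {K : metricType R} {N B : nat}
  (I : 'I_N -> {set 'I_B}) (S : 'I_N -> 'I_B -> K -> K).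
Implicit Types (u v w : Omega N) (s : seq 'I_B) (f g : K -> K) (h c : R).

Local Notation F := (attractor I S).

Lemma compw_shift w n s : compw S w n.+1 s = compw S (shift w) n s.
Proof. by elim: s n => //= j s IH n; rewrite IH. Qed.

(** A version of [validw] on plain sequences that reads letters through [shift], for induction on
    the word. *)
Fixpoint valid_word w s : bool :=
  if s is j :: s' then (j \in I (w 0%N)) && valid_word (shift w) s' else true.

Lemma validwE k w (t : k.-tuple 'I_B) : validw I w t = valid_word w t.
Proof.
elim: k w t => [|k IH] w t; first by rewrite tuple0; apply/forallP => -[].
case/tupleP: t => j t /=; rewrite -IH.
apply/forallP/andP => [H|[jI /forallP H] m].
  split; first by have := H ord0.
  by apply/forallP => m; have := H (lift ord0 m); rewrite tnthS.
case: (unliftP ord0 m) => [m' ->|->]; last by rewrite tnth0.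
by rewrite tnthS; exact: H.
Qed.

Lemma eq_compw k w w' (t : k.-tuple 'I_B) : agree k w w' ->
  compw S w 0 t = compw S w' 0 t.
Proof.
elim: k w w' t => [|k IH] w w' t ww'; first by rewrite tuple0.
case/tupleP: t => j t /=; rewrite !compw_shift ww'//.
by rewrite (IH _ _ t (agree_shift ww')).
Qed.

Lemma eq_lip_sum w w' h k : agree k w w' -> lip_sum I S w h k = lip_sum I S w' h k.
Proof.
move=> ww'; apply: eq_big => t; last by rewrite (eq_compw t ww').
by apply: eq_forallb => m; rewrite ww'.
Qed.

(** The level-[k] union from the definition of the attractor, rebuilt by peeling off the outermost
    map. *)
Fixpoint prefractal w k : set K :=
  if k is k'.+1 then
    \bigcup_(j in [set j | j \in I (w 0%N)]) S (w 0%N) j @` prefractal (shift w) k'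
  else setT.

Lemma prefractalE w k :
  \bigcup_(t in [set t : k.-tuple 'I_B | validw I w t]) (compw S w 0 t) @` [set: K]
  = prefractal w k.
Proof.
elim: k w => [|k IH] w.
  apply/seteqP; split=> // x _; exists [tuple]; last by exists x.
  by rewrite /= validwE.
rewrite /= -IH; apply/seteqP; split=> x.
  move=> [t]; case/tupleP: t => j t /=; rewrite validwE /= => /andP[jI vt].
  rewrite compw_shift => -[y _ <-]; exists j => //=.
  exists (compw S (shift w) 0 t y) => //; exists t; last by exists y.
  by rewrite /= validwE.
move=> [j /= jI [_ [t vt [y _ <-]] <-]]; exists [tuple of j :: t].
  by rewrite /= validwE /= jI -validwE.
by exists y => //=; rewrite compw_shift.
Qed.

Lemma attractorE w : F w = \bigcap_k prefractal w k.
Proof. by apply: eq_bigcapr => k _; exact: prefractalE. Qed.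

Lemma eq_prefractal k w w' : agree k w w' -> prefractal w k = prefractal w' k.
Proof.
elim: k w w' => [|k IH] w w' ww' //=; rewrite ww'//.
by rewrite (IH _ _ (agree_shift ww')).
Qed.

Lemma prefractal_decr w k l : (k <= l)%N -> prefractal w l `<=` prefractal w k.
Proof.
elim: k w l => [|k IH] w [|l]//= kl x [j jI [y Fy <-]].
by exists j => //; exists y => //; exact: IH Fy.
Qed.

Lemma attractor_sub_prefractal w k : F w `<=` prefractal w k.
Proof. by move=> x; rewrite attractorE => /(_ k); exact. Qed.

Lemma image_attractor_sub w j : j \in I (w 0%N) ->
  S (w 0%N) j @` F (shift w) `<=` F w.
Proof.
move=> jI _ [x Fx <-]; rewrite attractorE => -[|k] _ //=.
by exists j => //; exists x => //; exact: attractor_sub_prefractal.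
Qed.

Lemma word_image_attractor_sub w s : valid_word w s ->
  compw S w 0 s @` F (iter (size s) shift w) `<=` F w.
Proof.
elim: s w => [|j s IH] w /=; first by move=> _ _ [x Fx <-].
move=> /andP[jI vs] _ [x Fx <-] /=; apply: (image_attractor_sub jI).
exists (compw S w 1 s x) => //; rewrite compw_shift; apply: IH => //.
by exists x => //; rewrite -iterSr.
Qed.

(** With upper constant 1 the class contains the identity and is closed under composition, so it
    covers [compw] of every valid word, the empty one included. *)
Definition bilipschitz (f : K -> K) := exists2 c : R, 0 < c & forall x y,
  c * mdist x y <= mdist (f x) (f y) <= mdist x y.

Lemma bilipschitz_comp f g : bilipschitz f -> bilipschitz g -> bilipschitz (f \o g).
Proof.
move=> [c c0 cf] [d d0 dg]; exists (c * d) => [|x y]; first exact: mulr_gt0.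
have /andP[f1 f2] := cf (g x) (g y); have /andP[g1 g2] := dg x y.
rewrite /= (le_trans f2 g2) andbT; apply: le_trans f1.
by rewrite -mulrA ler_wpM2l// ltW.
Qed.

Lemma bilipschitz_inj f : bilipschitz f -> injective f.
Proof.
move=> [c c0 cf] x y fxy; apply: mdist_positivity; apply/eqP.
rewrite eq_le mdist_ge0 andbT -(pmulr_rle0 _ c0).
by have /andP[+ _] := cf x y; rewrite fxy mdistxx.
Qed.

Lemma bilipschitz_continuous f : bilipschitz f -> continuous f.
Proof.
move=> [c c0 cf] x; apply/cvg_ballP => e e0; near=> y.
rewrite ballEmdist /=; have /andP[_ fxy] := cf x y; apply: le_lt_trans fxy _.
suff : ball x e y by rewrite ballEmdist.
by near: y; exact: nbhsx_ballx.
Unshelve. all: by end_near. Qed.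

Lemma hausdorff_image_bilipschitz_le h f (X : set K) : 0 <= h -> bilipschitz f ->
  (hausdorff h (f @` X) <= hausdorff h X)%E.
Proof.
move=> h0 [c _ cf]; have := @hausdorff_image_le _ _ _ f id X h 1 h0 ltr01.
rewrite powR1 mul1e image_id; apply => x y.
by rewrite mul1r; have /andP[] := cf x y.
Qed.

Lemma hausdorff_image_ge h f c (X : set K) : 0 <= h -> 0 < c ->
  (forall x y, c * mdist x y <= mdist (f x) (f y)) ->
  ((c `^ h)%:E * hausdorff h X <= hausdorff h (f @` X))%E.
Proof.
move=> h0 c0 cf; have ch0 : 0 < c `^ h by rewrite powR_gt0.
(* Read backwards, the hypothesis says that points are at most [c^-1] times as far apart as their
   images; the resulting factor is then cancelled by [c ^ h]. *)
have := @hausdorff_image_le _ _ _ id f X h c^-1 h0; rewrite invr_gt0 image_id.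
move=> /(_ c0) H; rewrite -(_ : (c `^ h)%:E * ((c^-1 `^ h)%:E *
    hausdorff h (f @` X)) = hausdorff h (f @` X))%E.
  rewrite lee_pmul2l ?lte_fin//; apply: H => x y.
  by rewrite mulrC ler_pdivlMr// mulrC.
rewrite muleA -EFinM -powRM ?invr_ge0 ?(ltW c0)//.
by rewrite divff ?gt_eqF// powR1 mul1e.
Qed.

(** Two distinct points keep [Lipm f] finite: over no pairs at all the infimum is [+oo], whose
    [fine] is 0. *)
Lemma fine_Lipm_gt0 (a b : K) f : a <> b -> bilipschitz f ->
  0 < fine (Lipm f) /\ forall x y, fine (Lipm f) * mdist x y <= mdist (f x) (f y).
Proof.
move=> ab [c c0 cf].
have cL : (c%:E <= Lipm f)%E.
  apply/ereal_infP => _ [x [y [xy ->]]]; rewrite lee_fin ler_pdivlMr.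
    by have /andP[] := cf x y.
  by rewrite mdist_gt0; apply/eqP.
have Lf x y : x <> y -> (Lipm f <= (mdist (f x) (f y) / mdist x y)%:E)%E.
  by move=> xy; apply: ereal_inf_lbound; exists x, y.
have Lfin : Lipm f \is a fin_num.
  rewrite ge0_fin_numE; first exact: le_lt_trans (Lf _ _ ab) (ltry _).
  by apply: le_trans cL; rewrite lee_fin ltW.
split; first by rewrite -lte_fin fineK//; apply: lt_le_trans cL; rewrite lte_fin.
move=> x y; have [->|/eqP xy] := eqVneq x y; first by rewrite !mdistxx mulr0.
rewrite -ler_pdivlMr; first by rewrite -lee_fin fineK//; exact: Lf.
by rewrite mdist_gt0; apply/eqP.
Qed.

(** The chain [Lipm f <= Lipp f < 1] makes [Lipm f] finite, so its [fine] value can serve as the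
    lower constant. *)
Lemma bilipschitz_of_Lip f : (0 < Lipm f)%E -> (Lipm f <= Lipp f)%E ->
  (Lipp f < 1)%E -> bilipschitz f.
Proof.
move=> L0 LL L1; have Lfin : Lipm f \is a fin_num.
  rewrite ge0_fin_numE ?ltW//; apply: le_lt_trans LL _.
  by apply: lt_trans L1 _; rewrite ltry.
exists (fine (Lipm f)) => [|x y]; first by rewrite fine_gt0// L0 ltey_eq Lfin.
have [->|/eqP xy] := eqVneq x y; first by rewrite !mdistxx mulr0 lexx.
have d0 : 0 < mdist x y by rewrite mdist_gt0; apply/eqP.
apply/andP; split.
  rewrite -ler_pdivlMr// -lee_fin fineK//.
  by apply: ereal_inf_lbound; exists x, y.
rewrite -[leRHS]mul1r -ler_pdivrMr// -lee_fin; apply: le_trans (ltW L1).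
by apply: ereal_sup_ubound; exists x, y.
Qed.

(** * Decomposition and compactness of attractors *)

Hypothesis cK : compact [set: K].
Hypothesis S_bilipschitz : forall l j, j \in I l -> bilipschitz (S l j).

Lemma compw_bilipschitz w s : valid_word w s -> bilipschitz (compw S w 0 s).
Proof.
elim: s w => [|j s IH] w /=.
  by move=> _; exists 1 => // x y; rewrite mul1r !lexx.
move=> /andP[jI vs]; rewrite compw_shift.
by apply: bilipschitz_comp; [exact: S_bilipschitz|exact: IH].
Qed.

(** There are finitely many first letters, and each map is injective: a point in the images of all
    prefractals has a single preimage, which lies in the shifted attractor. *)
Lemma attractor_step w :
  F w = \bigcup_(j in [set j | j \in I (w 0%N)]) S (w 0%N) j @` F (shift w).
Proof.
apply/seteqP; split=> x; last by move=> [j /= jI]; exact: image_attractor_sub.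
move=> Fx; apply: contrapT => nFx.
(* A point outside all images of the shifted attractor leaves the image under letter [j] at some
   level [k j]; membership one level beyond the maximum of these is contradictory. *)
have /choice[k Hk] (j : 'I_B) : exists k, j \in I (w 0%N) ->
    ~ (S (w 0%N) j @` prefractal (shift w) k) x.
  have [jI|jI] := boolP (j \in I (w 0%N)); last by exists 0%N.
  apply: contrapT => H; apply: nFx; exists j => //.
  have {}H k : (S (w 0%N) j @` prefractal (shift w) k) x.
    by apply: contrapT => Hk; apply: H; exists k.
  have [y _ yx] := H 0%N; exists y => //; rewrite attractorE => k _.
  have [z zk zx] := H k.
  by rewrite (bilipschitz_inj (S_bilipschitz jI) (etrans yx (esym zx))).
have [j /= jI [y Fy yx]] := attractor_sub_prefractal (\max_j k j).+1 Fx.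
apply: (Hk j jI); exists y => //; apply: prefractal_decr Fy.
exact: leq_bigmax.
Qed.

Lemma image_compact w j (X : set K) : j \in I (w 0%N) -> compact X ->
  compact (S (w 0%N) j @` X).
Proof.
move=> jI; apply: continuous_compact; apply: continuous_subspaceT.
exact: bilipschitz_continuous (S_bilipschitz jI).
Qed.

Lemma prefractal_closed w k : closed (prefractal w k).
Proof.
suff : compact (prefractal w k).
  by apply: compact_closed; exact: metric_hausdorff.
elim: k w => [|k IH] w //=.
rewrite (bigcup_pred (mem (I (w 0%N)))); apply: bigsetU_compact => j jI.
exact: image_compact.
Qed.

Lemma attractor_compact w : compact (F w).
Proof.
apply: (subclosed_compact _ cK) => //; rewrite attractorE.
by apply: closed_bigI => k _; exact: prefractal_closed.
Qed.

(** The complements of the prefractals are open and increase to the complement of the attractor, so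
    one of them contains the compact complement of [U]. *)
Lemma prefractal_sub_open w (U : set K) : open U -> F w `<=` U ->
  exists k, prefractal w k `<=` U.
Proof.
move=> oU FU; have cU : compact (~` U).
  by apply: (subclosed_compact _ cK) => //; exact: open_closedC.
have [k _ Hk] : \forall k \near \oo, ~` U `<=` [set x | ~ prefractal w k x].
  move/compact_near_coveringP: cU => cU.
  apply: (cU nat (\oo : set_system nat) (fun k x => ~ prefractal w k x)).
  move=> x nUx; have : ~ F w x by move/FU.
  rewrite attractorE => nFx.
  have [k nk] : exists k, ~ prefractal w k x.
    by apply: contrapT => H; apply: nFx => k _; apply: contrapT => nk; apply: H; exists k.
  exists (~` prefractal w k, [set l | (k <= l)%N]) => /=.
    split; last by exists k.
    by apply: open_nbhs_nbhs; split => //; apply: closed_openC; exact: prefractal_closed.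
  by move=> [y l] /= [nky kl]; apply: contra_not nky; exact: prefractal_decr.
exists k => x Fx; apply: contrapT => nU.
exact: (Hk k (leqnn k) x nU).
Qed.

(** * Hausdorff measure of attractors and its typical value *)

Section Measure.
Variable h : R.
Hypothesis h_ge0 : 0 <= h.

Lemma hausdorff_attractor_step_le w :
  (hausdorff h (F w)
    <= \sum_(j in I (w 0%N)) hausdorff h (F (shift w)))%E.
Proof.
rewrite attractor_step (bigcup_pred (mem (I (w 0%N)))).
apply: le_trans (hausdorff_bigsetU _ _ _ _) _; apply: lee_sum => j jI.
by apply: hausdorff_image_bilipschitz_le => //; exact: S_bilipschitz.
Qed.

(** The maps are nonexpansive, so prepending a letter multiplies the measure by at most the number
    of maps of that letter; a prescribed prefix costs a fixed factor. *)
Lemma small_attractor_in_cylinder w k e :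
  ereal_inf [set hausdorff h (F u) | u in [set: Omega N]] = 0%E -> 0 < e ->
  exists2 w', agree k w' w & (hausdorff h (F w') < e%:E)%E.
Proof.
move=> inf0; elim: k w e => [|k IH] w e e0.
  have [|_ [u _ <-] ue] := @ereal_inf_lt _ [set hausdorff h (F u) | u in [set: Omega N]] e%:E.
    by rewrite inf0 lte_fin.
  by exists u.
pose n := #|I (w 0%N)|.
have n0 : 0 < n.+1%:R :> R by rewrite ltr0n.
(* Dividing by the number of maps plus one makes the final inequality strict. *)
have [|u uw ue] := IH (shift w) (e / n.+1%:R); first exact: divr_gt0.
exists (scons (w 0%N) u); first exact: agree_scons.
apply: le_lt_trans (hausdorff_attractor_step_le _) _.
apply: le_lt_trans (lee_sum _ (fun j _ => ltW ue)) _.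
rewrite sumEFin lte_fin sumr_const -/n -[ltLHS]mulr_natr mulrAC ltr_pdivrMr//.
by rewrite ltr_pM2l// ltr_nat.
Qed.

(** An open cover of [F w] already covers some prefractal, and this contains the attractor of every
    [u] with the same first letters. *)
Lemma Hdelta_lt_cylinder w delta c : 0 < delta ->
  (hausdorff h (F w) < c%:E)%E ->
  exists k, forall u, agree k u w -> (Hdelta h delta (F u) < c%:E)%E.
Proof.
move=> d0 Fc; have d2 : 0 < delta / 2 by rewrite divr_gt0.
(* Passing to open sets doubles the scale, hence the start at [delta / 2]. *)
have [|U [oU FU dU sU]] := @Hdelta_lt_open_cover _ _ h (delta / 2) (F w) c h_ge0 d2.
  by apply: le_lt_trans Fc; exact: Hdelta_le_hausdorff.
have [|k kU] := prefractal_sub_open _ FU; first by apply: bigcup_open => i _.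
exists k => u uw; apply: le_lt_trans sU; apply: Hdelta_le_cover => [x Fx|i].
  by apply: kU; rewrite -(eq_prefractal uw); exact: attractor_sub_prefractal Fx.
by apply: le_trans (dU i) _; rewrite lee_fin mulrC divfK.
Qed.

Lemma null_attractor_residual :
  ereal_inf [set hausdorff h (F u) | u in [set: Omega N]] = 0%E ->
  residualO (R := R) [set w | hausdorff h (F w) = 0%E].
Proof.
move=> inf0.
(* [Hdelta] grows as the scale shrinks, so bounds [1/(n+1)] at the scales [1/(n+1)] for all [n]
   force measure zero. *)
apply: (@residualO_cylinders _ _
  (fun n => [set w | Hdelta h n.+1%:R^-1 (F w) < (n.+1%:R^-1)%:E]%E)).
  move=> n w k; have n0 : 0 < n.+1%:R^-1 :> R by rewrite invr_gt0 ltr0n.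
  have [w' w'w w'n] := small_attractor_in_cylinder w k inf0 n0.
  by have [l Hl] := Hdelta_lt_cylinder n0 w'n; exists w', l.
move=> w Hw /=; apply/eqP; rewrite eq_le hausdorff_ge0 andbT.
apply/hausdorff_leP => d d0; apply/lee_addgt0Pr => e e0; rewrite add0e.
have m0 : 0 < Num.min d e by rewrite lt_min d0.
have [n _ /(_ n (leqnn n)) /=] := near_infty_natSinv_lt (PosNum m0).
rewrite lt_min => /andP[nd ne]; apply: le_trans (_ : _ <= (n.+1%:R^-1)%:E)%E _.
  apply: le_trans (ltW (Hw n)); exact: Hdelta_antimono (ltW nd).
by rewrite lee_fin ltW.
Qed.

Hypothesis S_separated : measure_separated I S (hausdorff h).

(** At the first position where the words differ, the separation condition applies to the sequence
    shifted past it; the common maps before it are injective and nonexpansive, so the intersection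
    stays null. *)
Lemma word_images_null w s s' : size s = size s' ->
  valid_word w s -> valid_word w s' -> s != s' ->
  hausdorff h (compw S w 0 s @` F (iter (size s) shift w)
    `&` compw S w 0 s' @` F (iter (size s) shift w)) = 0%E.
Proof.
elim: s s' w => [|j s IH] [|j' s'] w //= [ss'] /andP[jI vs] /andP[j'I vs'].
rewrite eqseq_cons !compw_shift -iterS iterSr => ne.
have wordsub t : valid_word (shift w) t -> size t = size s -> forall i x,
    ((S (w 0%N) i \o compw S (shift w) 0 t) @` F (iter (size s) shift (shift w))) x ->
    (S (w 0%N) i @` F (shift w)) x.
  move=> vt ts i _ [y Fy <-]; exists (compw S (shift w) 0 t y) => //.
  by apply: (word_image_attractor_sub vt); exists y; rewrite ?ts.
have [jj'|jj'] := eqVneq j j'; last first.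
  apply: hausdorff_null_sub (S_separated (shift w) jI j'I jj') => x [xs xs'].
  by split; [exact: wordsub xs|exact: wordsub xs'].
rewrite -{}jj' eqxx /= in ne *.
set X := F _.
apply: (@hausdorff_null_sub _ _ _ _ (S (w 0%N) j @` (compw S (shift w) 0 s @` X
    `&` compw S (shift w) 0 s' @` X))).
  move=> _ [[x Xx <-] [y Xy yx]]; exists (compw S (shift w) 0 s x) => //.
  split; first by exists x.
  by exists y => //; exact: bilipschitz_inj (S_bilipschitz jI) _ _ yx.
apply/eqP; rewrite eq_le hausdorff_ge0 andbT -(IH s' (shift w))//.
by apply: hausdorff_image_bilipschitz_le => //; exact: S_bilipschitz.
Qed.

Variables a b : K.
Hypothesis ab : a <> b.

(** The images under valid words of length [l] lie in [F w] and meet in null sets, so their measures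
    add up; each is at least [c] times the [h]-th power of the word's [Lipm]. *)
Lemma hausdorff_attractor_ge_lip_sum w l c : 0 <= c ->
  (c%:E <= hausdorff h (F (iter l shift w)))%E ->
  ((lip_sum I S w h l * c)%:E <= hausdorff h (F w))%E.
Proof.
move=> c0 cF; set X := F _ in cF.
have vb (t : l.-tuple 'I_B) : validw I w t -> bilipschitz (compw S w 0 t).
  by rewrite validwE; exact: compw_bilipschitz.
apply: (@le_trans _ _ (hausdorff h
    (\big[setU/set0]_(t : l.-tuple 'I_B | validw I w t) compw S w 0 t @` X))).
  apply: le_trans (hausdorff_bigsetU_null h_ge0 _ _ _); last 3 first.
  - exact: index_enum_uniq.
  - move=> t vt; apply: continuous_compact; last exact: attractor_compact.
    by apply: continuous_subspaceT; apply: bilipschitz_continuous; exact: vb.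
  - move=> t t'; rewrite !validwE => vt vt' tt'.
    have := @word_images_null w t t'; rewrite !size_tuple; exact.
  rewrite /lip_sum mulr_suml -sumEFin; apply: lee_sum => t vt.
  have [L0 Lf] := fine_Lipm_gt0 ab (vb _ vt).
  apply: le_trans (hausdorff_image_ge _ h_ge0 L0 Lf).
  by rewrite EFinM lee_pmul2l// lte_fin powR_gt0.
apply: hausdorffS; elim/big_ind: _ => // [Y Z YF ZF|t]; first by rewrite subUset.
rewrite validwE => vt; have := @word_image_attractor_sub w t vt.
by rewrite size_tuple.
Qed.

(** A cylinder around [v] serves for the empty prefix. Prepending a letter loses only a constant
    factor, made up for by raising the target [M], which is arbitrary in the induction. *)
Lemma large_attractors_in_cylinder v c w k M :
  (forall l, 0 < #|I l|)%N ->
  (fun l => (lip_sum I S v h l)%:E) @ \oo --> +oo%E ->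
  0 < c -> (forall u, c%:E <= hausdorff h (F u))%E ->
  exists w' l, agree k w' w /\
    forall u, agree l u w' -> (M%:E <= hausdorff h (F u))%E.
Proof.
move=> I0 /cvgeyPge limv c0 cF; elim: k w M => [|k IH] w M.
  (* Each unit of the Lipschitz sum carries measure at least [c], hence the threshold [M / c]. *)
  have [l _ /(_ l (leqnn l)) /=] := limv (M / c).
  rewrite lee_fin ler_pdivrMr// => Ml.
  exists v, l; split=> // u uv.
  apply: le_trans (hausdorff_attractor_ge_lip_sum (ltW c0) (cF (iter l shift u))).
  by rewrite (eq_lip_sum _ uv) lee_fin.
have /card_gt0P[j jI] := I0 (w 0%N).
have [d d0 dS] := S_bilipschitz jI.
(* The prepended map shrinks measure at most by the factor [d ^ h]. *)
have [w' [l [w'w Hl]]] := IH (shift w) (M / d `^ h).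
exists (scons (w 0%N) w'), l.+1; split; first exact: agree_scons.
move=> u uw; have u0 : u 0%N = w 0%N by rewrite uw.
apply: le_trans (_ : _ <= (d `^ h)%:E * hausdorff h (F (shift u)))%E _.
  have dh0 : 0 < d `^ h by rewrite powR_gt0.
  rewrite -lee_pdivrMl// -EFinM mulrC; apply: Hl; exact: agree_shift uw.
rewrite -u0 in jI dS; apply: le_trans (hausdorffS _ (image_attractor_sub jI)).
by apply: hausdorff_image_ge => // x y; have /andP[] := dS x y.
Qed.

Lemma infinite_attractor_residual v :
  (forall l, 0 < #|I l|)%N ->
  (fun l => (lip_sum I S v h l)%:E) @ \oo --> +oo%E ->
  (0 < ereal_inf [set hausdorff h (F u) | u in [set: Omega N]])%E ->
  residualO (R := R) [set w | hausdorff h (F w) = +oo%E].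
Proof.
move=> I0 limv inf0.
have [c c0 cF] : exists2 c : R, 0 < c & forall u, (c%:E <= hausdorff h (F u))%E.
  have infF u : (ereal_inf [set hausdorff h (F u) | u in [set: Omega N]]
      <= hausdorff h (F u))%E by apply: ereal_inf_lbound; exists u.
  (* The infimum itself serves as [c] unless it is infinite; then any positive constant does. *)
  case: (ereal_inf _) inf0 infF => [c||]// c0 cF; first by exists c.
  by exists 1 => // u; apply: le_trans (cF u); exact: leey.
apply: (@residualO_cylinders _ _ (fun n => [set w | n%:R%:E <= hausdorff h (F w)]%E)).
  by move=> n w k; exact: large_attractors_in_cylinder limv c0 cF.
move=> w Hw /=; apply/eqyP => M M0.
apply: le_trans (Hw (Num.truncn M).+1).
by rewrite lee_fin ltW// truncnS_gt.
Qed.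

End Measure.
End Attractors.

Lemma hdim_ge0 (R : realType) (K : metricType R) (N B : nat)
  (I : 'I_N -> {set 'I_B}) (S : 'I_N -> 'I_B -> K -> K) : 0 <= hdim I S.
Proof.
apply: fine_ge0; apply/ereal_infP => _ [u _ <-]; apply/ereal_infP => _ [r [r0 _] <-].
by rewrite lee_fin.
Qed.

Theorem theorem2p2 (R : realType) (K : metricType R) (N B : nat)
  (I : 'I_N -> {set 'I_B}) (S : 'I_N -> 'I_B -> K -> K) :
  compact [set: K] ->
  (forall l : 'I_N, (0 < #|I l|)%N) ->
  (forall (l : 'I_N) (j : 'I_B), j \in I l ->
     (0%E < Lipm (S l j))%E /\ (Lipm (S l j) <= Lipp (S l j))%E /\
     (Lipp (S l j) < 1%E)%E) ->
  measure_separated I S (hausdorff (hdim I S)) ->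
  (exists v : Omega N,
     (fun l => (lip_sum I S v (hdim I S) l)%:E) @ \oo --> +oo%E) ->
  ((ereal_inf [set hausdorff (hdim I S) (attractor I S u) | u in [set: Omega N]]
      = 0%E ->
    residualO (R := R) [set w : Omega N |
      hausdorff (hdim I S) (attractor I S w) = 0%E]) /\
   ((0%E < ereal_inf [set hausdorff (hdim I S) (attractor I S u)
                     | u in [set: Omega N]])%E ->
    residualO (R := R) [set w : Omega N |
      hausdorff (hdim I S) (attractor I S w) = +oo%E])).
Proof.
move=> cK I0 SL sep [v limv].
have S_bilip l j : j \in I l -> bilipschitz (S l j).
  by move=> /SL[L0 [LL L1]]; exact: bilipschitz_of_Lip.
have h0 := hdim_ge0 I S.
split=> inf0; first exact: null_attractor_residual.
have /card_gt0P[j jI] := I0 (v 0%N); have [_ [LL L1]] := SL _ _ jI.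
(* On a space with at most one point [Lipm] is an infimum over the empty set, that is [+oo], against
   [Lipm <= Lipp < 1]. *)
have [a [b ab]] : exists a b : K, a <> b.
  apply: contrapT => H.
  have LE : Lipm (S (v 0%N) j) = +oo%E.
    apply/eqP; rewrite -leye_eq; apply/ereal_infP => _ [x [y [xy ->]]].
    by case: H; exists x, y.
  by move: (le_lt_trans LL L1); rewrite LE.
exact: (infinite_attractor_residual cK S_bilip h0 sep ab I0 limv inf0).
Qed.
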